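(* Let $\{\beta_n\}_n$ be a sequence of nonnegative reals, let $\mathbf U=\{U_e\}_{e\in E(K_n)}$ be i.i.d. $\mathrm{Unif}[0,1]$ random variables, and couple $\mathsf{WST}_n^{\beta_n}$ and $\mathsf{MST}_n$ by using the same $\mathbf U$; let $\mathbb P$ be the corresponding probability. a) If $\beta_n\gg n^2\log n$, then $\lim_{n\to\infty}\mathbb P(\mathsf{WST}_n^{\beta_n}=\mathsf{MST}_n)=1$. b) If $\beta_n\ll n^2$, then $\lim_{n\to\infty}\mathbb P(\mathsf{WST}_n^{\beta_n}\neq\mathsf{MST}_n)=1$.
   Context: $K_n$ is the complete graph on $n$ vertices. $a_n\gg b_n$ (equivalently $b_n\ll a_n$) means $\lim_{n\to\infty}b_n/a_n=0$. Given $\mathbf U$, the weighted spanning tree $\mathsf{WST}_n^{\beta_n}$ is the random spanning tree of $K_n$ with $$\mathbb P(\mathsf{WST}_n^{\beta_n}=T\mid\mathbf U)=\frac{\exp(-\beta_n\sum_{e\in T}U_e)}{\sum_{T'}\exp(-\beta_n\sum_{e\in T'}U_e)},$$ the sum being over all spanning trees $T'$ of $K_n$. The minimum spanning tree $\mathsf{MST}_n$ is the (almost surely unique) spanning tree $T$ of $K_n$ minimizing $\sum_{e\in T}U_e$. *)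

(* Defs.v *)
From HB Require Import structures.
From mathcomp Require Import all_boot all_order all_algebra.
From mathcomp Require Import all_classical all_reals all_analysis.

Set Implicit Arguments.
Unset Strict Implicit.
Unset Printing Implicit Defensive.

Import Order.TTheory GRing.Theory Num.Theory.
Import numFieldNormedType.Exports.

Local Open Scope classical_set_scope.
Local Open Scope ring_scope.

(* b << a.  Division by zero yields zero here, so [a n != 0] for large [n],
   implicit in the convergence of [b n / a n], has to be required. *)
Definition negligible_wrt (R : realType) (b a : nat -> R) : Prop :=
  (\forall n \near \oo, a n != 0) /\ (b n / a n) @[n --> \oo] --> (0 : R).

Definition edge (n : nat) : finType := {e : {set 'I_n} | #|e| == 2%N}.

Definition adj (n : nat) (T : {set edge n}) : rel 'I_n :=
  fun x y => [exists e in T, val e == [set x; y]%SET].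

Definition connected_graph (n : nat) (T : {set edge n}) : Prop :=
  forall x y : 'I_n, connect (adj T) x y.

(* [ucycle] accepts the degenerate closed walk x, y, x along one edge, so a
   graph cycle is a [ucycle] with at least three vertices. *)
Definition acyclic_graph (n : nat) (T : {set edge n}) : Prop :=
  forall c : seq 'I_n, ucycle (adj T) c -> (size c <= 2)%N.

Definition spanning_tree (n : nat) (T : {set edge n}) : Prop :=
  connected_graph T /\ acyclic_graph T.

Definition weight (R : realType) (n : nat) (u : edge n -> R)
    (T : {set edge n}) : R :=
  \sum_(e in T) u e.

Definition gibbs (R : realType) (n : nat) (beta : R) (u : edge n -> R)
    (T : {set edge n}) : R :=
  expR (- beta * weight u T) /
  \sum_(T' : {set edge n} | `[< spanning_tree T' >]) expR (- beta * weight u T').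

Definition minimum_spanning_tree (R : realType) (n : nat) (u : edge n -> R)
    (T : {set edge n}) : Prop :=
  spanning_tree T /\
  forall T' : {set edge n}, spanning_tree T' -> weight u T <= weight u T'.

Section Probability.
Context (R : realType) (d : measure_display) (Omega : measurableType d).
Variable P : probability Omega R.

Definition mutually_independent (I : finType) (X : I -> {RV P >-> R}) : Prop :=
  forall (J : {set I}) (B : I -> set R),
    (forall i, measurable (B i)) ->
    (P (\bigcap_(i in [set` J]) (X i @^-1` B i)) =
     \prod_(i in J) P (X i @^-1` B i))%E.

Definition uniform01 (X : {RV P >-> R}) : Prop :=
  forall B : set R, measurable B ->
    distribution P X B = uniform_prob (@ltr01 R) B.

Definition iid_uniform01 (I : finType) (X : I -> {RV P >-> R}) : Prop :=
  mutually_independent X /\ forall i, uniform01 (X i).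

Definition sigma_of (I : Type) (X : I -> {RV P >-> R}) : set (set Omega) :=
  <<s \bigcup_i preimage_set_system setT (X i) measurable >>.

(* [f] is a version of the conditional probability of the event [E] given the
   sub-sigma-algebra [G]. *)
Definition is_cond_prob (G : set (set Omega)) (E : set Omega) (f : Omega -> R)
    : Prop :=
  (forall B : set R, measurable B -> G (f @^-1` B)) /\
  (forall A : set Omega, G A -> (P (A `&` E) = \int[P]_(w in A) (f w)%:E)%E).

Definition random_element (S : finType) (W : Omega -> S) : Prop :=
  forall s : S, measurable (W @^-1` [set s]).

(* The Gibbs weights sum to 1 over the spanning trees, so these identities
   also force [W] to be a spanning tree almost surely. *)
Definition is_WST (n : nat) (beta : R) (U : edge n -> {RV P >-> R})
    (W : Omega -> {set edge n}) : Prop :=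
  random_element W /\
  forall T : {set edge n}, spanning_tree T ->
    is_cond_prob (sigma_of U) (W @^-1` [set T])
      (fun w => gibbs beta (fun e => U e w) T).

(* The minimizer is only almost surely unique; [M] is unconstrained on a null
   event, so no tie-breaking rule is fixed. *)
Definition is_MST (n : nat) (U : edge n -> {RV P >-> R})
    (M : Omega -> {set edge n}) : Prop :=
  random_element M /\
  {ae P, forall w, minimum_spanning_tree (fun e => U e w) (M w)}.

End Probability.

(* Main.v *)
Require Import Defs.
From mathcomp Require Import all_boot all_order all_algebra.
From mathcomp Require Import all_classical all_reals all_analysis.
From mathcomp Require Import ring lra zify.
Import Order.TTheory GRing.Theory Num.Theory.
Import numFieldNormedType.Exports.
Local Open Scope classical_set_scope.
Local Open Scope ring_scope.

(* Spanning trees are the bases of the graphic matroid.  For an edge [e] outside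
   the minimum tree [M], let [tau_e] be the bottleneck value between its ends in
   the graph without [e]; it does not depend on [U_e], and it is the largest
   value on the [M]-path between the ends of [e].

   (a) The probability that some [U_e] lies within [delta] above [tau_e] is at
   most [m delta], where [m] is the number of edges.  Otherwise every exchange
   costs at least [delta], and mapping each tree [T <> M] to [T - e + f] shows
   that the other trees carry Gibbs mass at most [m^2 exp (- beta delta)].  Take
   [delta] of order [log n / beta].

   (b) Let [X] be the number of edges with [tau_e < U_e < tau_e + delta]; each
   gives a tree [M - f + e] of weight close to that of [M], so the Gibbs mass of
   [M] is at most [exp (2 beta delta) / X].  If two edges [e], [e'] are both of
   this kind, their bottlenecks are unchanged when both edges are deleted, so
   both occur with probability at most [delta^2], and Chebyshev's inequality
   gives [X >= m delta / 2] with high probability.  Take [1 / delta] between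
   [beta] and [n^2].

   The variables [U_e] are discretised into [K = 1 / delta] cells, which turns
   all these probabilities into counts of maps from the edges to ['I_K]. *)

Set Implicit Arguments.
Unset Strict Implicit.
Unset Printing Implicit Defensive.

(** * Spanning trees as bases of the graphic matroid *)

(* The closure operator of the graphic matroid of [K_n]. *)
Definition spans (n : nat) (S : {set edge n}) (e : edge n) : bool :=
  [forall x in val e, forall y in val e, connect (adj S) x y].

Lemma adj_sym (n : nat) (S : {set edge n}) : symmetric (adj S).
Proof. by move=> x y; apply: eq_existsb => f; rewrite finset.setUC. Qed.

Lemma connect_adjC (n : nat) (S : {set edge n}) (x y : 'I_n) :
  connect (adj S) x y = connect (adj S) y x.
Proof. exact: (sym_connect_sym (adj_sym S)). Qed.

Lemma spansP (n : nat) (S : {set edge n}) (e : edge n) (a b : 'I_n) :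
  val e = [set a; b]%SET -> spans S e = connect (adj S) a b.
Proof.
move=> eab; apply/idP/idP.
  move=> /forall_inP /(_ a); rewrite eab finset.set21 => /(_ isT).
  by move=> /forall_inP /(_ b); rewrite finset.set22; apply.
move=> cab; apply/forall_inP => x; rewrite eab => /finset.set2P xab.
apply/forall_inP => y /finset.set2P yab.
case: xab => ->; case: yab => -> //.
by rewrite connect_adjC.
Qed.

Lemma edge_ends (n : nat) (e : edge n) :
  exists a b : 'I_n, a != b /\ val e = [set a; b]%SET.
Proof.
case: e => A /= /cards2P[a [b [ab Aab]]].
by exists a, b.
Qed.

Lemma edge_between (n : nat) (a b : 'I_n) :
  a != b -> exists e : edge n, val e = [set a; b]%SET.
Proof.
move=> ab; have ab2 : #|[set a; b]%SET| == 2%N by rewrite cards2 ab.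
by exists (exist (fun A : {set 'I_n} => #|A| == 2%N) _ ab2).
Qed.

Lemma adjP (n : nat) (S : {set edge n}) (x y : 'I_n) :
  reflect (exists2 e, e \in S & val e = [set x; y]%SET) (adj S x y).
Proof.
apply: (iffP idP).
  by move=> /exists_inP[e eS /eqP exy]; exists e.
by move=> [e eS exy]; apply/exists_inP; exists e => //; apply/eqP.
Qed.

Lemma spans_mem (n : nat) (S : {set edge n}) (e : edge n) :
  e \in S -> spans S e.
Proof.
move=> eS; have [a [b [_ eab]]] := edge_ends e.
by rewrite (spansP _ eab); apply/connect1/adjP; exists e.
Qed.

Lemma spans_connect (n : nat) (S S' : {set edge n}) (x y : 'I_n) :
  (forall f, f \in S -> spans S' f) ->
  connect (adj S) x y -> connect (adj S') x y.
Proof.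
move=> SS'; apply: connect_sub => {}x {}y /adjP[f fS fxy].
by rewrite -(spansP _ fxy) SS'.
Qed.

Lemma spans_trans (n : nat) (S S' : {set edge n}) (e : edge n) :
  (forall f, f \in S -> spans S' f) -> spans S e -> spans S' e.
Proof.
have [a [b [_ eab]]] := edge_ends e.
by rewrite !(spansP _ eab); apply: spans_connect.
Qed.

Lemma spans_sub (n : nat) (S S' : {set edge n}) (e : edge n) :
  S \subset S' -> spans S e -> spans S' e.
Proof. by move=> /fintype.subsetP SS'; apply: spans_trans => f /SS'/spans_mem. Qed.

(** By induction on the walk, a repeated crossing of [g] can be removed, so one crossing in either
    direction suffices. *)
Lemma connect_setU1 (n : nat) (S : {set edge n}) (g : edge n) (x y a b : 'I_n) :
  val g = [set x; y]%SET -> connect (adj (g |: S)) a b ->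
  [\/ connect (adj S) a b,
      connect (adj S) a x /\ connect (adj S) y b |
      connect (adj S) a y /\ connect (adj S) x b].
Proof.
move=> gxy /connectP[p]; elim: p a => [|c p IH] a /=.
  by move=> _ ->; constructor 1.
move=> /andP[/adjP[f + fac] pcp] blast.
have tr := @connect_trans _ (adj S).
have {}IH := IH c pcp blast.
rewrite finset.in_setU1 => /predU1P[fg|fS]; last first.
  have ac : connect (adj S) a c by apply/connect1/adjP; exists f.
  case: IH => [h|[h1 h2]|[h1 h2]].
  - by constructor 1; apply: tr h.
  - by constructor 2; split=> //; apply: tr h1.
  - by constructor 3; split=> //; apply: tr h1.
have : a \in val g /\ c \in val g by rewrite -fg fac finset.set21 finset.set22.
rewrite gxy => -[/finset.set2P ax /finset.set2P cx].
have := fac; rewrite fg gxy => E.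
case: ax => ax; case: cx => cx; subst a c.
- case: IH => [h|[h1 h2]|[h1 h2]];
    by [constructor 1|constructor 2|constructor 3].
- case: IH => [h|[h1 h2]|[h1 h2]].
  + by constructor 2.
  + constructor 1; apply: tr h2; by rewrite connect_adjC.
  + by constructor 1.
- case: IH => [h|[h1 h2]|[h1 h2]].
  + by constructor 3.
  + by constructor 1.
  + constructor 1; apply: tr h2; by rewrite connect_adjC.
- case: IH => [h|[h1 h2]|[h1 h2]];
    by [constructor 1|constructor 2|constructor 3].
Qed.

(** Exchange property of the closure: the walk joining the ends of [e] has to cross [g], so its two
    halves together with [e] lead from one end of [g] to the other. *)
Lemma spans_exchange (n : nat) (S : {set edge n}) (e g : edge n) :
  spans (g |: S) e -> ~~ spans S e -> spans (e |: S) g.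
Proof.
have [a [b [_ eab]]] := edge_ends e; have [x [y [_ gxy]]] := edge_ends g.
rewrite !(spansP _ eab) (spansP _ gxy) => gSab nSab.
have tr := @connect_trans _ (adj (e |: S)).
have up u v : connect (adj S) u v -> connect (adj (e |: S)) u v.
  by apply: spans_connect => f fS; rewrite spans_mem// finset.setU1r.
have ab : connect (adj (e |: S)) a b.
  by rewrite -(spansP _ eab) spans_mem// finset.setU11.
case: (connect_setU1 gxy gSab) => [h|[h1 h2]|[h1 h2]].
- by rewrite h in nSab.
- apply: (tr a x y); first by rewrite connect_adjC; exact: up.
  by apply: (tr b a y) => //; rewrite connect_adjC; exact: up.
- apply: (tr b x y); first exact: up.
  by apply: (tr a b y); [rewrite connect_adjC|exact: up].
Qed.

Lemma connected_graphP (n : nat) (T : {set edge n}) :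
  connected_graph T <-> forall e, spans T e.
Proof.
split=> [cT e|sT x y].
  by have [a [b [_ eab]]] := edge_ends e; rewrite (spansP _ eab).
have [->|xy] := eqVneq x y; first exact: connect0.
by have [e exy] := edge_between xy; rewrite -(spansP _ exy).
Qed.

(** Acyclicity is independence in the matroid. A path that joins the ends of [e] and avoids [e]
    closes up to a cycle; conversely, a cycle without one of its edges still joins the ends of that
    edge. *)
Lemma acyclic_graphP (n : nat) (T : {set edge n}) :
  acyclic_graph T <-> forall e, e \in T -> ~~ spans (T :\ e) e.
Proof.
split=> [aT e eT|iT c].
  have [a [b [ab eab]]] := edge_ends e.
  rewrite (spansP _ eab); apply/negP => /connectP[p pp].
  case/shortenP: pp => q pq uq _ bq.
  have sub : subrel (adj (T :\ e)) (adj T).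
    move=> x y /adjP[f]; rewrite finset.in_setD1 => /andP[_ fT] fxy.
    by apply/adjP; exists f.
  have : ucycle (adj T) (a :: q).
    apply/andP; split=> //=; rewrite rcons_path (sub_path sub pq)/= -bq.
    by apply/adjP; exists e; rewrite // eab finset.setUC.
  (* At most two vertices leave two cases: no step, which would identify [a] and [b], and a single
     step, whose edge would have the ends of [e]. *)
  move=> /aT /=; case: q pq uq bq => [|c [|d q]]//=.
    by move=> _ _ E; rewrite E eqxx in ab.
  rewrite andbT => /adjP[f]; rewrite finset.in_setD1 => /andP[fe _] fac _ E _.
  by case/eqP: fe; apply/val_inj; rewrite fac eab E.
case: c => [|x [|y p]]//= /andP[]/=.
case: p => [//|z p] /andP[/adjP[e eT exy] pp] /andP[xp /andP[yp up]].
have /negP[] := iT e eT.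
rewrite (spansP _ exy) connect_adjC; apply/connectP.
exists (rcons (z :: p) x); last by rewrite last_rcons.
(* Among the steps that start at a vertex other than [x], only the one from [y] to [x] can run along
   [e]. *)
have no u v : adj T u v -> u \in y :: z :: p ->
  ~~ ((u == y) && (v == x)) -> adj (T :\ e) u v.
  move=> /adjP[f fT fuv] up' yx; apply/adjP; exists f => //.
  rewrite finset.in_setD1 fT andbT; apply/eqP => fe.
  have : u \in [set x; y]%SET /\ v \in [set x; y]%SET.
    by rewrite -exy -fe fuv finset.set21 finset.set22.
  case=> /finset.set2P[ux|uy] /finset.set2P[vx|vy].
  - by rewrite ux (negbTE xp) in up'.
  - by rewrite ux (negbTE xp) in up'.
  - by rewrite uy vx !eqxx in yx.
  - have := exy; rewrite -fe fuv uy vy => E.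
    have : x \in [set y; y]%SET by rewrite E finset.set21.
    by rewrite !inE orbb => /eqP xy; rewrite xy inE eqxx in xp.
move: pp => /=/andP[ayz pz]; rewrite no ?mem_head//=; last first.
  by move: xp; rewrite eqxx !inE !negb_or => /and3P[_ + _]; rewrite eq_sym.
have : all (fun u => (u \in y :: z :: p) && (u != y)) (z :: p).
  apply/allP => u uzp; rewrite inE uzp orbT/=.
  by apply: contraNneq yp => <-.
elim: p {xp yp up ayz} z (y :: z :: p) pz no => [|t p IH] z L /=.
  by rewrite !andbT => azx no /andP[zL zy]; rewrite no// negb_and zy.
move=> /andP[azt pt] no /andP[/andP[zL zy] al]; apply/andP; split.
  by apply: no => //; rewrite negb_and zy.
exact: (IH t L).
Qed.

Lemma spanning_treeP (n : nat) (T : {set edge n}) :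
  spanning_tree T <->
  (forall e, spans T e) /\ forall e, e \in T -> ~~ spans (T :\ e) e.
Proof. by rewrite /spanning_tree connected_graphP acyclic_graphP. Qed.

(** By exchange the new set spans the removed [f], hence all that [T] spans; if some [g] became
    redundant, exchange would make [T :\ f] span [e]. *)
Lemma spanning_tree_swap (n : nat) (T : {set edge n}) (e f : edge n) :
  spanning_tree T -> f \in T -> ~~ spans (T :\ f) e ->
  spanning_tree (e |: T :\ f).
Proof.
move=> /spanning_treeP[sT iT] fT nsp; apply/spanning_treeP; split.
  move=> g; apply: (@spans_trans _ T) => // h hT.
  have [->|hf] := eqVneq h f; last first.
    by rewrite spans_mem// finset.setU1r// finset.in_setD1 hf.
  by apply: spans_exchange => //; rewrite finset.setD1K.
have neTf : e \notin T :\ f by apply: contraNN nsp; apply: spans_mem.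
move=> g; rewrite finset.in_setU1 => /predU1P[->|gTf].
  by rewrite finset.setU1K.
have ge : g != e by apply: contraNneq neTf => <-.
move: gTf; rewrite finset.in_setD1 => /andP[gf gT].
have -> : (e |: T :\ f) :\ g = e |: T :\ f :\ g.
  apply/finset.setP => h; rewrite !inE.
  by have [->|] := eqVneq h g; rewrite ?(negbTE ge).
apply/negP => /spans_exchange H.
have : ~~ spans (T :\ f :\ g) g.
  apply: contraNN (iT g gT); apply: spans_sub.
  by rewrite finset.setSD// finset.subD1set.
move=> /H; rewrite finset.setD1K ?finset.in_setD1 ?gf//.
exact/negP.
Qed.

Lemma spans0 (n : nat) (e : edge n) : ~~ spans finset.set0 e.
Proof.
have [a [b [ab eab]]] := edge_ends e; rewrite (spansP _ eab).
apply/negP => /connectP[[|c p] /= + ba]; first by rewrite ba eqxx in ab.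
by move=> /andP[/adjP[f]]; rewrite inE.
Qed.

(** [S] is the tree path between the ends of [e], obtained as a minimal subset of [M] spanning [e].
    If [M :\ f] still spanned [e], minimality and exchange would make it span [f], against
    independence. *)
Lemma spanning_tree_path (n : nat) (M : {set edge n}) (e : edge n) :
  spanning_tree M ->
  exists S : {set edge n}, [/\ S \subset M, spans S e &
    forall f, f \in S -> ~~ spans (M :\ f) e].
Proof.
move=> /spanning_treeP[sM iM].
pose P (S : {set edge n}) := (S \subset M) && spans S e.
have PM : P M by rewrite /P subxx sM.
have [S /minsetP[/andP[SM sS] Smin] _] := minset_exists PM.
exists S; split=> // f fS; apply/negP => sMf.
have /negP[] := iM f (fintype.subsetP SM f fS).
have /(spans_trans _) : spans (e |: S :\ f) f.
  apply: spans_exchange; rewrite ?finset.setD1K//; apply/negP => sSf.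
  have : S :\ f = S.
    apply: Smin; rewrite ?finset.subD1set// /P sSf.
    by rewrite (fintype.subset_trans _ SM)// finset.subD1set.
  by move=> /finset.setP /(_ f); rewrite !inE eqxx fS.
apply=> g; rewrite finset.in_setU1 => /predU1P[->//|gSf].
by rewrite spans_mem//; move: gSf; apply/fintype.subsetP/finset.setSD.
Qed.

(** Symmetric basis exchange: if [T :\ e] spanned the whole path of [e] in [M], it would span [e];
    an edge [f] of the path that it misses serves for both trees. *)
Lemma spanning_tree_exchange (n : nat) (M T : {set edge n}) (e : edge n) :
  spanning_tree M -> spanning_tree T -> e \in T -> e \notin M ->
  exists f, [/\ f \in M, f != e, ~~ spans (M :\ f) e & ~~ spans (T :\ e) f].
Proof.
move=> Mtree /spanning_treeP[sT iT] eT eM.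
have [S [SM sS nS]] := spanning_tree_path e Mtree.
have [/existsP[f /andP[fS nf]]|/existsPn H] :=
  boolP [exists f, (f \in S) && ~~ spans (T :\ e) f]; last first.
  have /negP[] := iT e eT; apply: spans_trans sS => f fS.
  by move: (H f); rewrite fS negbK.
have fM := fintype.subsetP SM f fS.
by exists f; split=> //; [apply: contraNneq eM => <-|exact: nS].
Qed.

Lemma spanning_tree_sub_eq (n : nat) (M T : {set edge n}) :
  spanning_tree M -> spanning_tree T -> T \subset M -> T = M.
Proof.
move=> /spanning_treeP[sM iM] /spanning_treeP[sT iT] TM.
apply/eqP; rewrite finset.eqEsubset TM; apply/fintype.subsetP => f fM.
apply: contraT => fT; have /negP[] := iM f fM.
by apply: spans_sub (sT f); rewrite finset.subsetD1 TM.
Qed.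

Lemma weight_swap (R : realType) (n : nat) (u : edge n -> R)
    (T : {set edge n}) (e f : edge n) :
  f \in T -> e \notin T :\ f ->
  weight u (e |: T :\ f) = weight u T + (u e - u f).
Proof.
move=> fT eTf; rewrite /weight big_setU1//= [in RHS](big_setD1 f)//=.
by ring.
Qed.

(** * Minimum spanning trees under exchange *)

Section MinimumSpanningTree.
Context (R : realType) (n : nat) (u : edge n -> R) (M : {set edge n}).
Hypothesis Mmin : minimum_spanning_tree u M.

Lemma mst_swap_le (e f : edge n) :
  f \in M -> ~~ spans (M :\ f) e -> u f <= u e.
Proof.
move=> fM nsp; have [Mtree Mle] := Mmin.
have := Mle _ (spanning_tree_swap Mtree fM nsp).
rewrite weight_swap//; last by apply: contraNN nsp; apply: spans_mem.
by rewrite lerDl subr_ge0.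
Qed.

(* Every edge on the tree cycle closed by [e] is at most the bottleneck of any
   set spanning [e]. *)
Lemma mst_bottleneck (S : {set edge n}) (e f : edge n) :
  f \in M -> ~~ spans (M :\ f) e -> spans S e ->
  exists2 g, g \in S & u f <= u g.
Proof.
move=> fM nsp sS.
have [/existsP[g /andP[gS ng]]|/existsPn H] :=
  boolP [exists g, (g \in S) && ~~ spans (M :\ f) g].
  by exists g => //; apply: mst_swap_le.
case/negP: nsp; apply: spans_trans sS => g gS.
by move: (H g); rewrite gS negbK.
Qed.

(** A symmetric exchange between the two trees bounds [u e] and [u f] by each other, and injectivity
    then forces [e = f]. *)
Lemma mst_unique (M' : {set edge n}) :
  minimum_spanning_tree u M' -> injective u -> M' = M.
Proof.
move=> M'min uinj; have [Mt Mle] := Mmin; have [M't M'le] := M'min.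
apply: spanning_tree_sub_eq => //; apply/fintype.subsetP => e eM'.
apply: contraT => eM.
have [f [fM fe nM nM']] := spanning_tree_exchange Mt M't eM' eM.
have fle : u f <= u e := mst_swap_le fM nM.
have := M'le _ (spanning_tree_swap M't eM' nM').
rewrite weight_swap//; last by apply: contraNN nM'; apply: spans_mem.
rewrite lerDl subr_ge0 => ele; case/eqP: fe; apply: uinj.
by apply/eqP; rewrite eq_le fle.
Qed.

End MinimumSpanningTree.

(** * Counting colorings by their bottlenecks *)

Section Counting.
Context (I : finType) (K : nat).
Implicit Types (c : {ffun I -> 'I_K}) (i j : I) (k : 'I_K).

Definition ffun_upd c i k : {ffun I -> 'I_K} :=
  [ffun j => if j == i then k else c j].

Lemma ffun_updE c i k j : ffun_upd c i k j = if j == i then k else c j.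
Proof. by rewrite ffunE. Qed.

Lemma ffun_upd_twice c i k k' : ffun_upd (ffun_upd c i k) i k' = ffun_upd c i k'.
Proof. by apply/ffunP => j; rewrite !ffun_updE; case: (j == i). Qed.

Lemma ffun_upd_id c i : ffun_upd c i (c i) = c.
Proof. by apply/ffunP => j; rewrite !ffun_updE; case: eqP => // ->. Qed.

(** A discrete Fubini argument: neither [P] nor the threshold [g] depends on coordinate [i], so
    overwriting that coordinate by a free level is a bijection, whose inverse puts [g c] back. *)
Lemma card_fixed_coord (P : {ffun I -> 'I_K} -> bool)
    (g : {ffun I -> 'I_K} -> nat) i :
  (forall c k, P (ffun_upd c i k) = P c) ->
  (forall c k, g (ffun_upd c i k) = g c) ->
  (#|[set c | P c && (c i == g c :> nat)]%SET| * K =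
   #|[set c | P c && (g c < K)%N]%SET|)%N.
Proof.
move=> Pi gi; set A := finset _; set B := finset _.
rewrite -[X in (_ * X)%N](card_ord K) -cardsT -cardsX.
pose h (x : {ffun I -> 'I_K} * 'I_K) := ffun_upd x.1 i x.2.
have h_inj : {in finset.setX A [set: 'I_K]%SET &, injective h}.
  move=> [c k] [c' k']; rewrite !finset.in_setX !inE !andbT /=.
  move=> /andP[_ /eqP ci] /andP[_ /eqP c'i]; rewrite /h /= => E.
  have kk' : k = k'.
    by have := congr1 (fun c : {ffun I -> 'I_K} => c i) E; rewrite !ffun_updE eqxx.
  have gg : g c = g c' by rewrite -(gi c k) -(gi c' k') E.
  congr pair => //; apply/ffunP => j.
  have := congr1 (fun c : {ffun I -> 'I_K} => c j) E; rewrite !ffun_updE.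
  by case: eqP => // -> _; apply/val_inj; rewrite /= ci c'i.
rewrite -(card_in_imset h_inj); apply: eq_card => c; apply/imsetP/idP.
  move=> [[c' k]]; rewrite !finset.in_setX !inE /= andbT => /andP[Pc /eqP ci] ->.
  by rewrite Pi gi Pc -ci ltn_ord.
rewrite inE => /andP[Pc gK]; exists (ffun_upd c i (Ordinal gK), c i).
  by rewrite !finset.in_setX !inE /= Pi gi Pc ffun_updE eqxx andbT/=.
by rewrite /h /= ffun_upd_twice ffun_upd_id.
Qed.

Lemma card_fixed_coord_le (P : {ffun I -> 'I_K} -> bool)
    (g : {ffun I -> 'I_K} -> nat) i :
  (forall c k, P (ffun_upd c i k) = P c) ->
  (forall c k, g (ffun_upd c i k) = g c) ->
  (#|[set c | P c && (c i == g c :> nat)]%SET| * K <=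
   #|[set c | P c]%SET|)%N.
Proof.
move=> Pi gi; rewrite card_fixed_coord//; apply/subset_leq_card.
by apply/fintype.subsetP => c; rewrite !inE => /andP[].
Qed.

Lemma card_fixed_coord_leT (g : {ffun I -> 'I_K} -> nat) i :
  (forall c k, g (ffun_upd c i k) = g c) ->
  (#|[set c : {ffun I -> 'I_K} | c i == g c :> nat]%SET| * K <=
   #|{ffun I -> 'I_K}|)%N.
Proof.
move=> gi; have := @card_fixed_coord_le xpredT g i (fun _ _ => erefl) gi.
by move=> /leq_trans; apply; apply: max_card.
Qed.

End Counting.

(** * Discrete bottlenecks and tight edges *)

Section Bottleneck.
Context (n K : nat).
Local Notation coloring := {ffun edge n -> 'I_K}.
Implicit Types (c : coloring) (D : {set edge n}) (e f : edge n).

(** [D] collects deleted edges. The inequality is strict, so a [bottleneck] below [K] is one more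
    than the highest level on a best connection. *)
Definition below c D k : {set edge n} :=
  [set f | (f \notin D) && (c f < k)%N]%SET.

(* The value is [K] when no level below [K] connects the ends of [e]. *)
Definition bottleneck c D e : nat :=
  find (fun k => spans (below c D k) e) (iota 0 K).

Lemma bottleneck_spans c D e :
  (bottleneck c D e < K)%N -> spans (below c D (bottleneck c D e)) e.
Proof.
move=> bK; have /(nth_find 0%N) : has (fun k => spans (below c D k) e) (iota 0 K).
  by rewrite has_find size_iota.
by rewrite nth_iota.
Qed.

Lemma bottleneck_min c D e k :
  spans (below c D k) e -> (bottleneck c D e <= k)%N.
Proof.
move=> sk; have [Kk|kK] := leqP K k.
  by apply: leq_trans Kk; rewrite -[X in (_ <= X)%N](size_iota 0 K) find_size.
rewrite leqNgt; apply/negP => /(before_find 0%N).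
by rewrite nth_iota// sk.
Qed.

Lemma bottleneck_upd c D e f k :
  f \in D -> bottleneck (ffun_upd c f k) D e = bottleneck c D e.
Proof.
move=> fD; apply: eq_find => j; congr spans; apply/setP => h.
rewrite !inE ffun_updE; case: eqP => [->|//].
by rewrite fD.
Qed.

(* If [e'] is used to connect the ends of [e], it can be replaced by strictly
   lower edges, so the two coincidences are governed by bottlenecks that
   ignore both edges, hence by independent events. *)
Lemma bottleneck_pair c e e' :
  e' != e ->
  c e = bottleneck c [set e]%SET e :> nat ->
  c e' = bottleneck c [set e']%SET e' :> nat ->
  c e = bottleneck c [set e; e']%SET e :> nat.
Proof.
move=> ee' he he'; apply/eqP; rewrite eqn_leq; apply/andP; split.
  have [bK|Kb] := ltnP (bottleneck c [set e; e']%SET e) K; last first.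
    by apply: leq_trans Kb; apply: ltnW.
  rewrite {1}he; apply: bottleneck_min.
  apply: spans_sub (bottleneck_spans bK); apply/fintype.subsetP => f.
  by rewrite !inE negb_or => /andP[/andP[-> _] ->].
apply: bottleneck_min.
have sp : spans (below c [set e]%SET (c e)) e.
  by rewrite {1}he; apply: bottleneck_spans; rewrite -he.
apply: spans_trans sp => f; rewrite !inE => /andP[fe fc].
have [fe'|fe'] := eqVneq f e'; last first.
  by rewrite spans_mem// !inE negb_or fe fe'.
subst f.
have sp' : spans (below c [set e']%SET (c e')) e'.
  by rewrite {1}he'; apply: bottleneck_spans; rewrite -he'.
apply: spans_sub sp'; apply/fintype.subsetP => g; rewrite !inE negb_or.
move=> /andP[-> gc]; rewrite (ltn_trans gc fc) !andbT.
by apply: contraTneq gc => ->; rewrite -leqNgt ltnW.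
Qed.

(** These edges lie in the cell just above that of [tau_e]: the discrete form of
    [tau_e < U_e < tau_e + delta]. *)
Definition tight c : {set edge n} :=
  [set e | c e == bottleneck c [set e]%SET e :> nat]%SET.

(** Both the cell of [tau_e] and the next one are excluded, so an edge above [tau_e] is above it by
    at least a full cell. *)
Definition well_separated c : bool :=
  [forall e, ((c e).+1 != bottleneck c [set e]%SET e) &&
             (c e != bottleneck c [set e]%SET e :> nat)].

Lemma card_tight e :
  (#|[set c | e \in tight c]%SET| * K =
   #|[set c | bottleneck c [set e]%SET e < K]%SET|)%N.
Proof.
have := @card_fixed_coord _ K xpredT (fun c => bottleneck c [set e]%SET e) e
  (fun _ _ => erefl) (fun c k => bottleneck_upd c e k (set11 e)).
move=> /= <-; congr (_ * _)%N; apply: eq_card => c.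
by rewrite !inE.
Qed.

Lemma card_tight_le e :
  (#|[set c | e \in tight c]%SET| * K <= #|{: coloring}|)%N.
Proof. by rewrite card_tight max_card. Qed.

(** With both edges deleted, the two thresholds ignore both coordinates; releasing [e'] and then [e]
    gives one factor [K] each. *)
Lemma card_tight2_le e e' : e' != e ->
  (#|[set c : coloring | (e \in tight c) && (e' \in tight c)]%SET| * (K * K) <=
   #|{: coloring}|)%N.
Proof.
move=> ee'; pose g c := bottleneck c [set e; e']%SET e.
pose g' c := bottleneck c [set e; e']%SET e'.
have gi c k f : f \in [set e; e']%SET -> g (ffun_upd c f k) = g c.
  exact: bottleneck_upd.
have g'i c k f : f \in [set e; e']%SET -> g' (ffun_upd c f k) = g' c.
  exact: bottleneck_upd.
have sub : (#|[set c : coloring | (e \in tight c) && (e' \in tight c)]%SET| <=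
    #|[set c : coloring | (c e == g c :> nat) && (c e' == g' c :> nat)]%SET|)%N.
  apply/subset_leq_card/fintype.subsetP => c; rewrite !inE.
  move=> /andP[/eqP h /eqP h']; apply/andP; split; apply/eqP.
    exact: bottleneck_pair.
  rewrite /g' finset.setUC; apply: bottleneck_pair => //.
  by rewrite eq_sym.
apply: leq_trans (leq_mul sub (leqnn _)) _; rewrite mulnA.
apply: leq_trans (leq_mul _ (leqnn K)) _; last first.
- apply: (@card_fixed_coord_leT _ K g e) => c k; apply: gi; exact: finset.set21.
- apply: (@card_fixed_coord_le _ K (fun c : coloring => c e == g c :> nat) g' e').
  + move=> c k; rewrite ffun_updE [e == e']eq_sym (negbTE ee') gi// finset.set22//.
  + by move=> c k; apply: g'i; exact: finset.set22.
Qed.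

(** Union bound: each edge has two forbidden levels, its bottleneck and the level below it, each hit
    with probability at most [1 / K]. *)
Lemma card_not_separated :
  (#|[set c : coloring | ~~ well_separated c]%SET| * K <=
   2 * #|{: edge n}| * #|{: coloring}|)%N.
Proof.
pose A e := [set c : coloring | c e == (bottleneck c [set e]%SET e).-1 :> nat]%SET.
pose B e := [set c : coloring | c e == bottleneck c [set e]%SET e :> nat]%SET.
have sub : (#|[set c : coloring | ~~ well_separated c]%SET| <=
    \sum_e (#|A e| + #|B e|))%N.
  apply: (@leq_trans #|(\bigcup_e (A e :|: B e))%SET|).
    apply/subset_leq_card/fintype.subsetP => c; rewrite inE negb_forall.
    move=> /existsP[e]; rewrite negb_and !negbK => h.
    apply/bigcupP; exists e => //; rewrite !inE.
    by case/orP: h => [/eqP <-|->]; rewrite ?eqxx ?orbT.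
  elim/big_ind2: _ => [|S k T l Sk Tl|e _]; first by rewrite cards0.
    by rewrite (leq_trans (leq_card_setU _ _).1)// leq_add.
  by rewrite (leq_card_setU _ _).1.
apply: leq_trans (leq_mul sub (leqnn _)) _; rewrite big_distrl/=.
rewrite [(2 * _)%N]mulnC -mulnA -sum_nat_const; apply: leq_sum => e _.
rewrite mulnDl mul2n -addnn; apply: leq_add.
- apply: card_fixed_coord_leT => c k; congr _.-1; apply: bottleneck_upd.
  exact: set11.
- by apply: card_fixed_coord_leT => c k; apply: bottleneck_upd; exact: set11.
Qed.

Lemma card_top_coord f :
  (#|[set c : coloring | (c f < K.-1)%N == false]%SET| * K <= #|{: coloring}|)%N.
Proof.
have := @card_fixed_coord_leT _ K (fun _ => K.-1) f (fun _ _ => erefl).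
apply: leq_trans; rewrite leq_mul2r; apply/orP; right.
apply/subset_leq_card/fintype.subsetP => c; rewrite !inE => /eqP/negbT.
rewrite -leqNgt eqn_leq => ->; rewrite andbT.
by rewrite -ltnS prednK ?(leq_ltn_trans _ (ltn_ord (c f)))// ltn_ord.
Qed.

(* A third vertex gives a path of two edges, each at level [K - 1] with
   probability [1 / K]. *)
Lemma card_bottleneck_top e : (2 < n)%N ->
  (#|[set c | (K <= bottleneck c [set e]%SET e)%N]%SET| * K <=
   2 * #|{: coloring}|)%N.
Proof.
move=> n2; have [a [b [ab eab]]] := edge_ends e.
have [z zab] : exists z, z \notin [set a; b]%SET.
  apply/existsP; rewrite -negb_forall; apply/negP => /forallP H.
  have : (#|[set: 'I_n]%SET| <= #|[set a; b]%SET|)%N.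
    by apply/subset_leq_card/fintype.subsetP => z _; move: (H z).
  by rewrite cardsT card_ord cards2 ab leqNgt n2.
move: zab; rewrite !inE negb_or => /andP[za zb].
have [f faz] := edge_between za; have [h hzb] := edge_between zb.
have fe : f != e.
  apply/eqP => fe; have := finset.set21 z a; rewrite -faz fe eab !inE.
  by rewrite (negbTE za) (negbTE zb).
have he : h != e.
  apply/eqP => he; have := finset.set21 z b; rewrite -hzb he eab !inE.
  by rewrite (negbTE za) (negbTE zb).
have [K0|K0] := posnP K.
  by rewrite [X in (_ * X)%N]K0 muln0.
have sub : (#|[set c | (K <= bottleneck c [set e]%SET e)%N]%SET| <=
   #|[set c : coloring | (c f < K.-1)%N == false]%SET| +
   #|[set c : coloring | (c h < K.-1)%N == false]%SET|)%N.
  apply: leq_trans (leq_card_setU _ _).1.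
  apply/subset_leq_card/fintype.subsetP => c; rewrite !inE => Kb.
  apply: contraTT Kb; rewrite negb_or !eqbF_neg !negbK => /andP[cf ch].
  rewrite -ltnNge -[X in (_ < X)%N](prednK K0) ltnS.
  apply: bottleneck_min; rewrite (spansP _ eab).
  apply: (@connect_trans _ _ z).
    rewrite connect_adjC; apply/connect1/adjP; exists f => //.
    by rewrite !inE fe.
  by apply/connect1/adjP; exists h => //; rewrite !inE he.
apply: leq_trans (leq_mul sub (leqnn _)) _.
by rewrite mulnDl mul2n -addnn leq_add// card_top_coord.
Qed.

End Bottleneck.

(** * First two moments of the number of tight edges *)

Section SecondMoment.
Context (R : realType) (n K : nat).
Hypotheses (n2 : (2 < n)%N) (K0 : (0 < K)%N).
Local Notation coloring := {ffun edge n -> 'I_K}.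

Let m : R := #|{: edge n}|%:R.
Let N : R := #|{: coloring}|%:R.
Let k : R := K%:R.
Let mu : R := m / k.

Lemma card_tight_sum (c : coloring) :
  #|tight c|%:R = \sum_e (e \in tight c)%:R :> R.
Proof.
rewrite -sum1_card natr_sum [RHS](bigID (mem (tight c)))/= [X in _ + X]big1 ?addr0.
  by apply: eq_bigr => e ->.
by move=> e /negbTE ->.
Qed.

Lemma sum_pred_card (T : finType) (A : pred T) :
  \sum_(c : T) (A c)%:R = #|[set c | A c]%SET|%:R :> R.
Proof.
rewrite -sum1_card natr_sum [LHS](bigID A)/= [X in _ + X]big1 ?addr0.
  by apply: eq_big => [c|c ->//]; rewrite inE.
by move=> c /negbTE ->.
Qed.

Let k0 : 0 < k. Proof. by rewrite ltr0n. Qed.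

(** An edge is tight with probability [1 / K] times that of a bottleneck below [K]; the detour
    through a third vertex makes the latter at least [1 - 2 / K]. *)
Lemma tight_first_moment_ge :
  mu * N * (1 - 2 / k) <= \sum_(c : coloring) #|tight c|%:R.
Proof.
under eq_bigr do rewrite card_tight_sum.
rewrite exchange_big/=.
under eq_bigr do rewrite sum_pred_card.
have -> : mu * N * (1 - 2 / k) = \sum_(e : edge n) (N * (1 - 2 / k) / k).
  by rewrite sumr_const -[RHS]mulr_natl -/m /mu; field; rewrite gt_eqF.
apply: ler_sum => e _; rewrite ler_pdivrMr//.
rewrite -natrM card_tight.
set B := [set c : coloring | (K <= bottleneck c [set e]%SET e)%N]%SET.
have -> : [set c : coloring | (bottleneck c [set e]%SET e < K)%N]%SET = (~: B)%SET.
  by apply/finset.setP => c; rewrite !inE ltnNge.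
have BN : #|B|%:R * k <= 2 * N.
  by have := card_bottleneck_top K e n2; rewrite -(ler_nat R) 2!natrM.
have NB : N = #|B|%:R + #|(~: B)%SET|%:R by rewrite -natrD cardsC.
have : #|B|%:R <= N * (2 / k) by rewrite mulrA ler_pdivlMr// [N * 2]mulrC.
by lra.
Qed.

(** The diagonal contributes at most [mu * N], and each pair of distinct edges at most
    [N / k ^+ 2]. *)
Lemma tight_second_moment_le :
  \sum_(c : coloring) #|tight c|%:R ^+ 2 <= mu * N + mu ^+ 2 * N.
Proof.
have -> : \sum_(c : coloring) #|tight c|%:R ^+ 2 = \sum_(e : edge n)
    \sum_(e' : edge n)
      #|[set c : coloring | (e \in tight c) && (e' \in tight c)]%SET|%:R :> R.
  under eq_bigr => c _ do rewrite card_tight_sum expr2 big_distrlr/=.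
  rewrite exchange_big; apply: eq_bigr => e _.
  rewrite exchange_big; apply: eq_bigr => e' _.
  rewrite -sum_pred_card; apply: eq_bigr => c _.
  by rewrite -natrM mulnb.
have -> : mu * N + mu ^+ 2 * N = \sum_(e : edge n) (N / k + m * (N / k ^+ 2)).
  by rewrite sumr_const -[RHS]mulr_natl -/m /mu; field; rewrite gt_eqF.
apply: ler_sum => e _; rewrite (bigD1 e)//=; apply: lerD.
  rewrite ler_pdivlMr//.
  have := @card_tight_le n K e; rewrite -(ler_nat R) natrM; apply: le_trans.
  rewrite ler_pM2r// ler_nat; apply/subset_leq_card/fintype.subsetP => c.
  by rewrite !inE andbb.
apply: (@le_trans _ _ (\sum_(e' : edge n | e' != e) (N / k ^+ 2))).
  apply: ler_sum => e' e'e; rewrite ler_pdivlMr ?exprn_gt0//.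
  by have := card_tight2_le K e'e; rewrite -(ler_nat R) natrM natrM.
rewrite sumr_const -[X in X <= _]mulr_natl ler_wpM2r//.
  by rewrite divr_ge0// exprn_ge0// ltW.
by rewrite ler_nat max_card.
Qed.

(** Chebyshev around [mu], which only approximates the mean: the defect in the first moment adds
    [4 * mu ^+ 2 * N / k] to the bound [mu * N]. Division by [(mu / 2) ^+ 2] yields the two
    terms. *)
Lemma card_few_tight : (0 < #|{: edge n}|)%N ->
  #|[set c : coloring | #|tight c|%:R <= mu / 2]%SET|%:R <=
  (4 / mu + 16 / k) * N.
Proof.
move=> m0; have mu0 : 0 < mu by rewrite divr_gt0// ltr0n.
have chebyshev :
    #|[set c : coloring | #|tight c|%:R <= mu / 2]%SET|%:R * (mu / 2) ^+ 2 <=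
    \sum_(c : coloring) (#|tight c|%:R - mu) ^+ 2.
  rewrite -sum_pred_card mulr_suml; apply: ler_sum => c _.
  case: (boolP (_ <= mu / 2)) => [le|_]; last by rewrite mul0r sqr_ge0.
  rewrite mul1r -[in leRHS](sqrrN (_ - _)) opprB.
  by rewrite lerXn2r ?nnegrE; lra.
have variance : \sum_(c : coloring) (#|tight c|%:R - mu) ^+ 2 <=
    mu * N + 4 * mu ^+ 2 * N / k.
  have -> : \sum_(c : coloring) (#|tight c|%:R - mu) ^+ 2 =
     \sum_(c : coloring) #|tight c|%:R ^+ 2
      - 2 * mu * (\sum_(c : coloring) #|tight c|%:R) + mu ^+ 2 * N.
    have -> : mu ^+ 2 * N = \sum_(c : coloring) mu ^+ 2.
      by rewrite sumr_const -[RHS]mulr_natr.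
    rewrite mulr_sumr -sumrB -big_split/=; apply: eq_bigr => c _; ring.
  have h1 := tight_second_moment_le; have h2 := tight_first_moment_ge.
  have h3 : 2 * mu * (mu * N * (1 - 2 / k)) <=
      2 * mu * (\sum_(c : coloring) #|tight c|%:R).
    by rewrite ler_pM2l// mulr_gt0.
  have e3 : 2 * mu * (mu * N * (1 - 2 / k)) =
    2 * (mu ^+ 2 * N) - 4 * mu ^+ 2 * N / k by field; rewrite gt_eqF.
  by lra.
have sq0 : 0 < (mu / 2) ^+ 2 by rewrite exprn_gt0// divr_gt0.
rewrite -(ler_pM2r sq0).
apply: le_trans (le_trans chebyshev variance) _.
suff -> : (4 / mu + 16 / k) * N * (mu / 2) ^+ 2 =
  mu * N + 4 * mu ^+ 2 * N / k by [].
by field; rewrite !gt_eqF.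
Qed.

End SecondMoment.

(** * Gibbs mass of the minimum spanning tree *)

Section CellBounds.
Context (R : realType) (n K : nat) (beta : R) (u : edge n -> R).
Context (c : {ffun edge n -> 'I_K}) (M : {set edge n}).
Hypotheses (beta0 : 0 <= beta) (Mmin : minimum_spanning_tree u M).
Hypothesis uc : forall e, (c e)%:R / K%:R <= u e < (c e).+1%:R / K%:R.

Let k0 (e : edge n) : 0 < K%:R :> R.
Proof. by rewrite ltr0n (leq_ltn_trans _ (ltn_ord (c e))). Qed.

Lemma cell_le (e f : edge n) : u e <= u f -> (c e <= c f)%N.
Proof.
move=> ef; have /andP[h _] := uc e; have /andP[_ h'] := uc f.
have := le_lt_trans h (le_lt_trans ef h').
by rewrite ltr_pM2r ?invr_gt0 ?k0// ltr_nat ltnS.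
Qed.

(** The tree path of [e] has levels at most [c e], so the bottleneck is at most [c e + 1];
    separation excludes the two top values. Some edge [g] with [u f <= u g] lies below the
    bottleneck, hence at least two levels under [e]. *)
Lemma separated_gap (e f : edge n) : well_separated c ->
  e \notin M -> f \in M -> ~~ spans (M :\ f) e -> K%:R^-1 <= u e - u f.
Proof.
move=> /forallP /(_ e) /andP[sep1 sep2] eM fM nsp.
have Mtree := Mmin.1.
have [S [SM sS nS]] := spanning_tree_path e Mtree.
have bS : (bottleneck c [set e]%SET e <= (c e).+1)%N.
  apply: bottleneck_min; apply: spans_sub sS; apply/fintype.subsetP => g gS.
  have gM := fintype.subsetP SM g gS.
  rewrite !inE ltnS (cell_le (mst_swap_le Mmin gM (nS _ gS))) andbT.
  by apply: contraNneq eM => <-.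
have {sep1 sep2 bS} bc : (bottleneck c [set e]%SET e < c e)%N.
  move: bS; rewrite leq_eqVlt eq_sym (negbTE sep1)/= ltnS.
  by rewrite leq_eqVlt eq_sym (negbTE sep2).
have bK := ltn_trans bc (ltn_ord _).
have [g gb fg] := mst_bottleneck Mmin fM nsp (bottleneck_spans bK).
move: gb; rewrite !inE => /andP[_ gb].
have /andP[he _] := uc e; have /andP[_ hg] := uc g.
have cge : ((c g).+2 <= c e)%N by apply: leq_ltn_trans bc.
have : (c g).+2%:R / K%:R <= (c e)%:R / K%:R :> R.
  by rewrite ler_pM2r ?invr_gt0 ?(k0 e)// ler_nat.
rewrite -[(c g).+2]addn1 natrD mulrDl mul1r => h.
by lra.
Qed.

(** Strictly lower edges span [e], so [e] is not in [M]. Its tree path cannot stay two or more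
    levels below [e], since the bottleneck would then be smaller than [c e]. *)
Lemma tight_gap (e : edge n) : e \in tight c ->
  e \notin M /\
  exists f, [/\ f \in M, ~~ spans (M :\ f) e & u e - u f <= 2 / K%:R].
Proof.
rewrite inE => /eqP ceb.
have Mtree := Mmin.1; have [sM iM] := (spanning_treeP M).1 Mtree.
have bK : (bottleneck c [set e]%SET e < K)%N by rewrite -ceb.
have eM : e \notin M.
  apply/negP => eM.
  have [g] := mst_bottleneck Mmin eM (iM e eM) (bottleneck_spans bK).
  by rewrite !inE -ceb => /andP[_ gc] /cell_le; rewrite leqNgt gc.
split=> //.
have [S [SM sS nS]] := spanning_tree_path e Mtree.
have [/existsP[f /andP[fS bf]]|/existsPn H] :=
    boolP [exists f, (f \in S) && (c e <= (c f).+1)%N].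
  exists f; split; [exact: (fintype.subsetP SM)|exact: nS|].
  have /andP[_ he] := uc e; have /andP[hf _] := uc f.
  have : (c e).+1%:R / K%:R <= (c f).+2%:R / K%:R :> R.
    by rewrite ler_pM2r ?invr_gt0 ?(k0 e)// ler_nat ltnS.
  by rewrite -[(c f).+2]addn2 natrD mulrDl => h; lra.
(* Against tightness, this bound survives only at level [0], where the tree path would be empty. *)
have bb : (bottleneck c [set e]%SET e <= (c e).-1)%N.
  apply: bottleneck_min; apply: spans_sub sS; apply/fintype.subsetP => f fS.
  move: (H f); rewrite fS/= -ltnNge => cf.
  have fe : f != e by apply: contraNneq eM => <-; apply: (fintype.subsetP SM).
  by rewrite !inE fe /=; move: cf; case: (nat_of_ord (c e)).
have c0 : c e = 0%N :> nat.
  by move: bb; rewrite -ceb; case: (nat_of_ord (c e)) => // j; rewrite ltnn.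
have : spans finset.set0 e.
  by apply: spans_sub sS; apply/fintype.subsetP => f fS; move: (H f); rewrite fS c0.
by rewrite (negbTE (spans0 e)).
Qed.

Let boltz (T : {set edge n}) : R := expR (- beta * weight u T).
Let Z : R := \sum_(T : {set edge n} | `[< spanning_tree T >]) boltz T.

Let boltz_gt0 T : 0 < boltz T. Proof. exact: expR_gt0. Qed.

Let Z_gt0 : 0 < Z.
Proof.
rewrite /Z (bigD1 M)/=; last by apply/asboolP; exact: Mmin.1.
by rewrite ltr_pwDl// sumr_ge0// => T _; apply: ltW.
Qed.

(** The trees [phi e] are distinct, because [e] is the only edge of [phi e] outside [M]. Each weighs
    at most [2 / K] more than [M], and their Boltzmann factors sum to at most [Z]. *)
Lemma gibbs_tight_le : gibbs beta u M * #|tight c|%:R <= expR (2 * (beta / K%:R)).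
Proof.
have /boolp.choice[f fP] : forall e, exists f, e \in tight c ->
    [/\ f \in M, ~~ spans (M :\ f) e & u e - u f <= 2 / K%:R].
  move=> e; have [et|_] := boolP (e \in tight c); last by exists e.
  by have [_ [g gP]] := tight_gap et; exists g.
pose phi e := e |: M :\ f e.
have phiI : {in tight c &, injective phi}.
  move=> e e' et e't E; have [eM _] := tight_gap et.
  have := finset.setU11 e (M :\ f e); rewrite -/(phi e) E finset.in_setU1.
  by case/predU1P => //; rewrite finset.in_setD1 (negbTE eM) andbF.
rewrite /gibbs -/(boltz M) -/Z mulrAC ler_pdivrMr//.
rewrite mulrC; have -> : #|tight c|%:R * boltz M = \sum_(e in tight c) boltz M.
  by rewrite sumr_const mulr_natl.
apply: (@le_trans _ _ (\sum_(e in tight c) expR (2 * (beta / K%:R)) * boltz (phi e))).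
  apply: ler_sum => e et; have [fM nsp gap] := fP e et.
  rewrite /boltz -expRD ler_expR weight_swap//; last first.
    by apply: contraNN nsp; apply: spans_mem.
  have := ler_wpM2l beta0 gap.
  by lra.
rewrite -mulr_sumr ler_pM2l ?expR_gt0// -(big_imset boltz phiI)/=.
rewrite /Z [leRHS](bigID (mem (phi @: tight c)))/=.
rewrite ler_wpDr ?sumr_ge0//; first by move=> T _; apply: ltW.
rewrite le_eqVlt; apply/orP; left; apply/eqP; apply: eq_bigl => T.
apply/idP/andP => [Tphi|[]//]; split=> //; apply/asboolP.
case/imsetP: Tphi => e et ->; have [fM nsp _] := fP e et.
exact: spanning_tree_swap Mmin.1 fM nsp.
Qed.

(** Every tree [T <> M] has an exchange that lowers its weight by at least [1 / K], which costs a
    factor [eps]; the pair of exchanged edges recovers [T] from its image. *)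
Lemma gibbs_separated_ge : well_separated c ->
  1 - #|{: edge n}|%:R ^+ 2 * expR (- (beta / K%:R)) <= gibbs beta u M.
Proof.
move=> sep; set eps := expR _; set m := #|_|.
(* Summing over all pairs of edges and all trees [T'] avoids recording which exchange was chosen for
   [T]. *)
have swap T : spanning_tree T -> T != M -> boltz T <=
    \sum_(e : edge n) \sum_(f : edge n)
      \sum_(T' : {set edge n} | `[< spanning_tree T' >])
        (T == e |: T' :\ f)%:R * (eps * boltz T').
  move=> Ttree TM.
  have [e eT eM] : exists2 e, e \in T & e \notin M.
    apply/fintype.subsetPn; apply: contra TM => TM.
    by apply/eqP; apply: spanning_tree_sub_eq => //; exact: Mmin.1.
  have [f [fM fe nM nT]] := spanning_tree_exchange Mmin.1 Ttree eT eM.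
  have gap := separated_gap sep eM fM nM.
  have fTe : f \notin T :\ e by apply: contraNN nT; apply: spans_mem.
  pose T0 := f |: T :\ e.
  have ge0 e' f' T' : 0 <= (T == e' |: T' :\ f')%:R * (eps * boltz T').
    by rewrite mulr_ge0// mulr_ge0// ltW// expR_gt0.
  apply: (@le_trans _ _ (eps * boltz T0)).
    rewrite /boltz -expRD ler_expR weight_swap//.
    by have := ler_wpM2l beta0 gap; lra.
  rewrite (bigD1 e)//= ler_wpDr//.
    by rewrite !sumr_ge0// => e' _; rewrite sumr_ge0// => f' _; rewrite sumr_ge0.
  rewrite (bigD1 f)//= ler_wpDr//.
    by rewrite sumr_ge0// => f' _; rewrite sumr_ge0.
  rewrite (bigD1 T0)/=; last by apply/asboolP; exact: spanning_tree_swap.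
  rewrite ler_wpDr ?sumr_ge0//.
  by rewrite /T0 finset.setU1K// finset.setD1K// eqxx mul1r.
have others : \sum_(T | `[< spanning_tree T >] && (T != M)) boltz T <=
    m%:R ^+ 2 * eps * Z.
  apply: (@le_trans _ _ (\sum_(T | `[< spanning_tree T >] && (T != M))
     \sum_(e : edge n) \sum_(f : edge n)
      \sum_(T' : {set edge n} | `[< spanning_tree T' >])
        (T == e |: T' :\ f)%:R * (eps * boltz T'))).
    by apply: ler_sum => T /andP[/asboolP Tt TM]; apply: swap.
  (* Once the sums are exchanged, [e], [f] and [T'] determine [T], so each pair of edges contributes
     at most [eps * Z]. *)
  rewrite exchange_big/=.
  have -> : m%:R ^+ 2 * eps * Z = \sum_(e : edge n) \sum_(f : edge n) (eps * Z).
    by rewrite !sumr_const -[RHS]mulr_natl -[X in _ = _ * X]mulr_natl -/m expr2 !mulrA.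
  apply: ler_sum => e _; rewrite exchange_big/=; apply: ler_sum => f _.
  rewrite exchange_big/= /Z mulr_sumr; apply: ler_sum => T' _.
  rewrite -mulr_suml ler_piMl//; first by rewrite mulr_ge0// ltW// expR_gt0.
  rewrite big_mkcond/= (bigD1 (e |: T' :\ f))//= [X in _ + X]big1 ?addr0.
    by case: ifP => //; rewrite eqxx.
  by move=> T /negbTE ->; case: ifP.
rewrite /gibbs -/(boltz M) -/Z ler_pdivlMr//.
have : Z = boltz M + \sum_(T | `[< spanning_tree T >] && (T != M)) boltz T.
  by rewrite /Z (bigD1 M)//; apply/asboolP; exact: Mmin.1.
by lra.
Qed.

End CellBounds.

(** * Discretising the uniform weights *)

Section FiniteUnions.
Context (R : realType) (d : measure_display) (Omega : measurableType d).
Variable P : probability Omega R.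

Lemma prob_fin_bigcup (I : finType) (A : {set I}) (F : I -> set Omega) :
  (forall i, measurable (F i)) ->
  (forall i j w, F i w -> F j w -> i = j) ->
  P (\bigcup_(i in [set` A]) F i) = (\sum_(i in A) P (F i))%E.
Proof.
move=> mF tF.
have -> : [set` A] = [set` enum A] by apply/seteqP; split=> i /=; rewrite mem_enum.
rewrite measure_fin_bigcup//.
- by rewrite -fsbig_seq ?enum_uniq// big_enum.
- by move=> i j _ _ [w []]; apply: tF.
Qed.

Lemma prob_le_off_null (N A B : set Omega) :
  measurable A -> measurable B -> P.-negligible N ->
  (forall w, ~ N w -> A w -> B w) -> (P A <= P B)%E.
Proof.
move=> mA mB [N' [mN' N'0 NN']] AB.
apply: (@le_trans _ _ (P (B `|` N'))).
  apply: le_measure; rewrite ?inE//; first exact: measurableU.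
  move=> w Aw; have [Nw|nN] := pselect (N w); first by right; apply: NN'.
  by left; apply: AB.
by apply: le_trans (measureU2 P mB mN') _; rewrite [X in (_ + X)%E]N'0 adde0.
Qed.

End FiniteUnions.

Section Grid.
Context (R : realType) (d : measure_display) (Omega : measurableType d).
Context (P : probability Omega R) (n : nat) (U : edge n -> {RV P >-> R}).
Hypothesis U_iid : iid_uniform01 U.

Lemma sigma_of_measurable : sigma_of U `<=` measurable.
Proof.
apply: smallest_sub; first exact: sigma_algebra_measurable.
move=> _ [e _] [B mB <-]; rewrite setTI.
by rewrite -[X in measurable X]setTI; apply: measurable_funP.
Qed.

Lemma sigma_of_preimage (e : edge n) (B : set R) :
  measurable B -> sigma_of U (U e @^-1` B).
Proof.
move=> mB; apply: sub_sigma_algebra; exists e => //.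
by exists B => //; rewrite setTI.
Qed.

(** Half-open, so that the cells of one grid are disjoint; the point [1] lies in none of the first
    [K] cells. *)
Definition grid_cell (K j : nat) : set R := `[j%:R / K%:R, j.+1%:R / K%:R[.

Lemma prob_grid_cell (K j : nat) (e : edge n) : (j < K)%N ->
  P (U e @^-1` grid_cell K j) = (K%:R^-1)%:E.
Proof.
move=> jK; have K0 : 0 < K%:R :> R by rewrite ltr0n (leq_ltn_trans _ jK).
have mC : measurable (grid_cell K j) by exact: measurable_itv.
have := U_iid.2 e _ mC; rewrite /distribution /pushforward => ->.
rewrite /uniform_prob (eq_integral (cst 1%E)); last first.
  move=> x; rewrite inE /grid_cell/= in_itv/= => /andP[jx xj].
  rewrite /uniform_pdf subr0 invr1 ifT//; apply/andP; split.
    by apply: le_trans jx; rewrite divr_ge0.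
  apply: ltW (lt_le_trans xj _).
  by rewrite ler_pdivrMr// mul1r ler_nat.
rewrite integral_cst//= mul1e lebesgue_measure_itv/= lte_fin.
rewrite ltr_pM2r ?invr_gt0// ltr_nat ltnSn -EFinB -mulrBl.
by rewrite -[j.+1]addn1 natrD addrAC subrr add0r mul1r.
Qed.

Section GridEvent.
Variable K : nat.
Local Notation coloring := {ffun edge n -> 'I_K}.

Definition grid_box (c : coloring) : set Omega :=
  \bigcap_(e in [set` [set: edge n]%SET]) U e @^-1` grid_cell K (c e).

Definition grid_event (A : {set coloring}) : set Omega :=
  \bigcup_(c in [set` A]) grid_box c.

Lemma grid_boxP (c : coloring) (w : Omega) : grid_box c w ->
  forall e, (c e)%:R / K%:R <= U e w < (c e).+1%:R / K%:R.
Proof.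
move=> cw e; have : e \in [set: edge n]%SET by rewrite inE.
by move=> /cw; rewrite /grid_cell /= in_itv.
Qed.

(** The conditional probability identity is available only for events of [sigma_of U]. Through
    [g_sigma_algebraType] these become the measurable sets of a type, with the usual closure
    lemmas. *)
Lemma sigma_of_grid_box (c : coloring) : sigma_of U (grid_box c).
Proof.
pose G := \bigcup_i preimage_set_system setT (U i) measurable.
apply: (@fin_bigcap_measurable _ (g_sigma_algebraType G)) => //.
by move=> e _; apply: sigma_of_preimage; exact: measurable_itv.
Qed.

Lemma sigma_of_grid_event (A : {set coloring}) : sigma_of U (grid_event A).
Proof.
pose G := \bigcup_i preimage_set_system setT (U i) measurable.
apply: (@fin_bigcup_measurable _ (g_sigma_algebraType G)) => //.
by move=> c _; apply: sigma_of_grid_box.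
Qed.

Lemma prob_grid_box (c : coloring) : P (grid_box c) = (#|{: coloring}|%:R^-1)%:E.
Proof.
rewrite U_iid.1; last by move=> e; exact: measurable_itv.
under eq_bigr do rewrite prob_grid_cell//.
rewrite prodEFin prodr_const cardsT card_ffun card_ord natrX exprVn.
by [].
Qed.

Lemma prob_grid_event (A : {set coloring}) :
  P (grid_event A) = (#|A|%:R / #|{: coloring}|%:R)%:E.
Proof.
rewrite prob_fin_bigcup.
- under eq_bigr do rewrite prob_grid_box.
  by rewrite sumEFin sumr_const mulr_natl.
- by move=> c; apply: sigma_of_measurable; exact: sigma_of_grid_box.
move=> c c' w /grid_boxP cw /grid_boxP c'w; apply/ffunP => e.
have k0 : 0 < K%:R^-1 :> R.
  by rewrite invr_gt0 ltr0n (leq_ltn_trans _ (ltn_ord (c e))).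
have /andP[h1 h2] := cw e; have /andP[h3 h4] := c'w e.
apply/val_inj/eqP; rewrite eqn_leq.
have := le_lt_trans h1 h4; have := le_lt_trans h3 h2.
by rewrite !ltr_pM2r// !ltr_nat !ltnS => -> ->.
Qed.

End GridEvent.

(** Distinctness of the weights is witnessed by some grid that puts them in different cells; this
    makes it a countable union of grid events. *)
Definition tie_free : set Omega :=
  \bigcup_K grid_event [set c : {ffun edge n -> 'I_K} | injectiveb c]%SET.

Lemma sigma_of_tie_free : sigma_of U tie_free.
Proof.
pose G := \bigcup_i preimage_set_system setT (U i) measurable.
apply: (@bigcupT_measurable _ (g_sigma_algebraType G)) => K.
exact: sigma_of_grid_event.
Qed.

Lemma tie_free_inj (w : Omega) : tie_free w -> injective (fun e => U e w).
Proof.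
move=> [K _ [c /=]]; rewrite inE => /injectiveP cinj /grid_boxP cw e f ef.
apply: cinj; apply/val_inj/eqP.
have k0 : 0 < K%:R^-1 :> R.
  by rewrite invr_gt0 ltr0n (leq_ltn_trans _ (ltn_ord (c e))).
have /andP[h1 h2] := cw e; have /andP[h3 h4] := cw f.
rewrite eqn_leq; move: h1 h2; rewrite ef => h1 h2.
have := le_lt_trans h1 h4; have := le_lt_trans h3 h2.
by rewrite !ltr_pM2r// !ltr_nat !ltnS => -> ->.
Qed.

Lemma card_not_injective (K : nat) :
  (#|[set c : {ffun edge n -> 'I_K} | ~~ injectiveb c]%SET| * K <=
   #|{: edge n}| ^ 2 * #|{: {ffun edge n -> 'I_K}}|)%N.
Proof.
pose A (x : edge n * edge n) := [set c : {ffun edge n -> 'I_K} |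
  (x.1 != x.2) && (c x.1 == c x.2 :> nat)]%SET.
have sub : (#|[set c : {ffun edge n -> 'I_K} | ~~ injectiveb c]%SET| <=
    \sum_x #|A x|)%N.
  apply: (@leq_trans #|(\bigcup_x A x)%SET|).
    apply/subset_leq_card/fintype.subsetP => c; rewrite inE.
    move=> /injectivePn[e [f fe cef]]; apply/bigcupP; exists (e, f) => //.
    by rewrite !inE/= fe cef eqxx.
  elim/big_ind2: _ => [|S k T l Sk Tl|x _]; rewrite ?cards0//.
  by rewrite (leq_trans (leq_card_setU _ _).1)// leq_add.
apply: leq_trans (leq_mul sub (leqnn _)) _.
rewrite big_distrl/= -mulnn -card_prod -sum_nat_const; apply: leq_sum.
move=> [e f] _; rewrite /A/=; have [->|ef] := eqVneq e f.
  by rewrite (_ : finset _ = finset.set0) ?cards0//; apply/finset.setP => c; rewrite !inE.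
apply: (@card_fixed_coord_leT _ K (fun c => c f) e) => c k.
by rewrite ffun_updE eq_sym (negbTE ef).
Qed.

Lemma prob_tie_free : P tie_free = 1%E.
Proof.
have mT : measurable tie_free by apply: sigma_of_measurable; exact: sigma_of_tie_free.
apply/eqP; rewrite eq_le probability_le1//=.
apply/lee_addgt0Pr => eps eps0.
set m := #|{: edge n}|.
(* A grid so fine that the collision probability, at most [m ^+ 2 / K], is below [eps]. *)
pose K := (Num.truncn (m%:R ^+ 2 / eps)).+1.
have mK : m%:R ^+ 2 / K%:R <= eps.
  rewrite ler_pdivrMr// mulrC -ler_pdivrMr//.
  by rewrite ltW// truncnS_gt.
pose B := [set c : {ffun edge n -> 'I_K} | injectiveb c]%SET.
have N0 : (0 < #|{: {ffun edge n -> 'I_K}}|)%N.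
  by apply/card_gt0P; exists [ffun=> ord0].
apply: (@le_trans _ _ (P (grid_event B) + eps%:E)%E); last first.
  apply: leeD => //; apply: le_measure; rewrite ?inE//.
    by apply: sigma_of_measurable; exact: sigma_of_grid_event.
  by move=> w Bw; exists K.
rewrite prob_grid_event -EFinD lee_fin -lerBlDr ler_pdivlMr ?ltr0n//.
have := card_not_injective K; rewrite -(ler_nat R) !natrM.
have : #|~: B|%:R + #|B|%:R = #|{: {ffun edge n -> 'I_K}}|%:R :> R.
  by rewrite -natrD addnC cardsC.
have -> : (~: B)%SET = [set c : {ffun edge n -> 'I_K} | ~~ injectiveb c]%SET.
  by apply/finset.setP => c; rewrite !inE.
set b := #|_|%:R; set g := #|_|%:R; set N := #|_|%:R => bgN bKN.
have : b <= m%:R ^+ 2 / K%:R * N by rewrite mulrAC ler_pdivlMr.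
have : m%:R ^+ 2 / K%:R * N <= eps * N by rewrite ler_wpM2r.
by lra.
Qed.

End Grid.

(** * Agreement probability *)

Lemma gibbs_ge0 (R : realType) (n : nat) (beta : R) (u : edge n -> R)
    (T : {set edge n}) : 0 <= gibbs beta u T.
Proof. by rewrite divr_ge0 ?expR_ge0// sumr_ge0// => T' _; apply: expR_ge0. Qed.

Section Coupling.
Context (R : realType) (d : measure_display) (Omega : measurableType d).
Context (P : probability Omega R) (n : nat) (beta : R).
Context (U : edge n -> {RV P >-> R}) (W M : Omega -> {set edge n}).
Hypothesis U_iid : iid_uniform01 U.
Hypothesis beta0 : 0 <= beta.
Hypothesis W_WST : is_WST beta U W.
Hypothesis M_MST : is_MST U M.

Let agree : set Omega := [set w | W w = M w].

(** [M] is free on a null event and need not be measurable for [sigma_of U]; this event replaces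
    [M = T] where one conditions on the weights. *)
Let minimal_at (T : {set edge n}) : set Omega :=
  [set w | minimum_spanning_tree (fun e => U e w) T].

Let sigma_measurable := @sigma_of_measurable R d Omega P n U.

Lemma measurable_agree : measurable agree.
Proof.
have -> : agree = \bigcup_(T in [set` [set: {set edge n}]%SET])
    (W @^-1` [set T] `&` M @^-1` [set T]).
  apply/seteqP; split=> [w wagree|w [T _ [/= WT MT]]].
    by exists (W w); rewrite /= ?inE//; split=> //=; rewrite -wagree.
  by rewrite /agree /= WT MT.
apply: fin_bigcup_measurable => // T _.
by apply: measurableI; [exact: W_WST.1|exact: M_MST.1].
Qed.

Lemma sigma_of_minimal_at (T : {set edge n}) : sigma_of U (minimal_at T).
Proof.
pose G := \bigcup_i preimage_set_system setT (U i) measurable.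
have mU e : measurable_fun [set: g_sigma_algebraType G] (U e).
  by move=> _ B mB; rewrite setTI; apply: sigma_of_preimage.
have mw T' : measurable_fun [set: g_sigma_algebraType G]
    (fun w => weight (fun e => U e w) T').
  rewrite /weight; under eq_fun do rewrite -big_enum.
  exact: measurable_sum.
have [Tt|nT] := pselect (spanning_tree T); last first.
  have -> : minimal_at T = set0 by apply/seteqP; split=> // w [].
  exact: (@measurable0 _ (g_sigma_algebraType G)).
have -> : minimal_at T = \bigcap_(T' in [set T' | spanning_tree T'])
    ([set: g_sigma_algebraType G] `&`
     [set w | weight (fun e => U e w) T <= weight (fun e => U e w) T']).
  apply/seteqP; split=> [w [_ wT] T' /= T't|w wT]; first by split=> //; exact: wT.
  by split=> // T' /wT[].
apply: (@fin_bigcap_measurable _ (g_sigma_algebraType G)) => // T' _.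
exact: measurable_fun_le.
Qed.

Section Event.
Variable A : set Omega.
Hypotheses (sA : sigma_of U A) (A_inj : A `<=` tie_free U).

Let piece T := A `&` minimal_at T.

Let sigma_piece T : sigma_of U (piece T).
Proof.
pose G := \bigcup_i preimage_set_system setT (U i) measurable.
exact: (@measurableI _ (g_sigma_algebraType G)) sA (sigma_of_minimal_at T).
Qed.

Let piece_disjoint T T' w : piece T w -> piece T' w -> T = T'.
Proof.
move=> [Aw Tw] [_ T'w]; apply: (mst_unique T'w Tw).
exact/tie_free_inj/A_inj.
Qed.

Lemma prob_minimal_pieces :
  P A = (\sum_(T in [set: {set edge n}]%SET) P (piece T))%E.
Proof.
rewrite -prob_fin_bigcup//; last by move=> T; apply: sigma_measurable; exact: sigma_piece.
have mU : measurable (\bigcup_(T in [set` [set: {set edge n}]%SET]) piece T).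
  by apply: fin_bigcup_measurable => // T _; apply: sigma_measurable; exact: sigma_piece.
have mA := sigma_measurable sA.
apply/eqP; rewrite eq_le; apply/andP; split; last first.
  by apply: le_measure; rewrite ?inE//; move=> w [T _ []].
apply: (prob_le_off_null mA mU M_MST.2) => w /contrapT Mw Aw.
by exists (M w); rewrite /= ?inE.
Qed.

(** Without ties the minimum is unique, so [M = T] almost surely on [piece T], and agreement there
    means [W = T]. *)
Lemma prob_agree_pieces : P (A `&` agree) =
  (\sum_(T in [set: {set edge n}]%SET) P (piece T `&` W @^-1` [set T]))%E.
Proof.
have mp T : measurable (piece T `&` W @^-1` [set T]).
  by apply: measurableI; [apply: sigma_measurable; exact: sigma_piece|exact: W_WST.1].
rewrite -prob_fin_bigcup//; last first.
  by move=> T T' w [pT _] [pT' _]; exact: piece_disjoint pT pT'.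
have mU : measurable (\bigcup_(T in [set` [set: {set edge n}]%SET])
    (piece T `&` W @^-1` [set T])).
  exact: fin_bigcup_measurable.
have mA : measurable (A `&` agree).
  by apply: measurableI measurable_agree; exact: sigma_measurable.
apply/eqP; rewrite eq_le; apply/andP; split.
- apply: (prob_le_off_null mA mU M_MST.2) => w /contrapT Mw [Aw WM].
  by exists (M w); rewrite /= ?inE.
- apply: (prob_le_off_null mU mA M_MST.2) => w /contrapT Mw [T _ [Tw WT]].
  split; first exact: Tw.1.
  rewrite /agree/= WT; apply: (piece_disjoint Tw); split=> //.
  exact: Tw.1.
Qed.

Let measurable_gibbs T : spanning_tree T ->
  measurable_fun setT (fun w => gibbs beta (fun e => U e w) T).
Proof.
move=> Tt _ B mB; rewrite setTI; apply: sigma_measurable.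
exact: (W_WST.2 T Tt).1.
Qed.

Let piece0 T : ~ spanning_tree T -> piece T = set0.
Proof. by move=> nT; apply/seteqP; split=> // w [_ []]. Qed.

(** On each piece the conditional probability identity writes the probability of [W = T] as the
    integral of a Gibbs weight, which is compared with the constant [a]. *)
Lemma prob_agree_ge (a : R) : 0 <= a ->
  (forall w T, A w -> minimal_at T w -> a <= gibbs beta (fun e => U e w) T) ->
  (a%:E * P A <= P agree)%E.
Proof.
move=> a0 aA; apply: (@le_trans _ _ (P (A `&` agree))); last first.
  apply: le_measure; rewrite ?inE//; last exact: measurable_agree.
  by apply: measurableI measurable_agree; exact: sigma_measurable.
rewrite prob_minimal_pieces prob_agree_pieces ge0_sume_distrr//.
apply: lee_sum => T _; have [Tt|nT] := pselect (spanning_tree T); last first.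
  by rewrite piece0// set0I measure0 mule0.
have mp := sigma_measurable (sigma_piece T).
rewrite (W_WST.2 T Tt).2// -integral_cst//; apply: ge0_le_integral => //.
- apply/measurable_realfun.measurable_EFinP; apply: measurable_funTS.
  exact: measurable_gibbs.
- by move=> w [Aw Tw]; rewrite /= lee_fin; exact: aA.
Qed.

Lemma prob_agree_le (b : R) :
  (forall w T, A w -> minimal_at T w -> gibbs beta (fun e => U e w) T <= b) ->
  0 <= b -> (P (A `&` agree) <= b%:E * P A)%E.
Proof.
move=> bA b0; rewrite prob_minimal_pieces prob_agree_pieces ge0_sume_distrr//.
apply: lee_sum => T _; have [Tt|nT] := pselect (spanning_tree T); last first.
  by rewrite piece0// set0I measure0 mule0.
have mp := sigma_measurable (sigma_piece T).
rewrite (W_WST.2 T Tt).2// -integral_cst//; apply: ge0_le_integral => //.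
- by move=> w _; rewrite lee_fin gibbs_ge0.
- apply/measurable_realfun.measurable_EFinP; apply: measurable_funTS.
  exact: measurable_gibbs.
- by move=> w [Aw Tw]; rewrite /= lee_fin; exact: bA.
Qed.

End Event.

(** Intersecting with [tie_free] makes the minimum tree unique and leaves the probability of the
    grid event unchanged. *)
Let mesh_event K (A : {set {ffun edge n -> 'I_K}}) :=
  grid_event U A `&` tie_free U.

Let sigma_mesh_event K (A : {set {ffun edge n -> 'I_K}}) :
  sigma_of U (mesh_event A).
Proof.
pose G := \bigcup_i preimage_set_system setT (U i) measurable.
apply: (@measurableI _ (g_sigma_algebraType G)).
  exact: sigma_of_grid_event.
exact: sigma_of_tie_free.
Qed.

Let prob_mesh_event K (A : {set {ffun edge n -> 'I_K}}) :
  P (mesh_event A) = (#|A|%:R / #|{: {ffun edge n -> 'I_K}}|%:R)%:E.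
Proof.
rewrite -(prob_grid_event U_iid).
have mg : measurable (grid_event U A).
  by apply: sigma_measurable; exact: sigma_of_grid_event.
have mt : measurable (tie_free U).
  by apply: sigma_measurable; exact: sigma_of_tie_free.
have null : P.-negligible (~` tie_free U).
  exists (~` tie_free U); split=> //; first exact: measurableC.
  by rewrite probability_setC// prob_tie_free// subee.
have mm := sigma_measurable (sigma_mesh_event A).
apply/eqP; rewrite eq_le; apply/andP; split.
  by apply: le_measure; rewrite ?inE//; move=> w [].
by apply: (prob_le_off_null mg mm null) => w /contrapT tw gw.
Qed.

Let m : R := #|{: edge n}|%:R.

Let total_gt0 K : (0 < K)%N -> 0 < #|{: {ffun edge n -> 'I_K}}|%:R :> R.
Proof.
move=> K0; rewrite ltr0n; apply/card_gt0P.
by exists [ffun=> Ordinal K0].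
Qed.

Lemma prob_agree_ge_mesh (K : nat) : (0 < K)%N ->
  m ^+ 2 * expR (- (beta / K%:R)) <= 1 ->
  ((1 - m ^+ 2 * expR (- (beta / K%:R)) - 2 * m / K%:R)%:E <= P agree)%E.
Proof.
move=> K0; set eps := m ^+ 2 * _ => eps1.
have eps0 : 0 <= eps by rewrite mulr_ge0 ?exprn_ge0 ?expR_ge0// ler0n.
pose B := [set c : {ffun edge n -> 'I_K} | well_separated c]%SET.
have sub : mesh_event B `<=` tie_free U by move=> w [].
have main : ((1 - eps)%:E * P (mesh_event B) <= P agree)%E.
  apply: (prob_agree_ge (sigma_mesh_event B) sub); first by rewrite subr_ge0.
  move=> w T [[c /= + cw] _] Tw; rewrite inE => cs.
  exact: (gibbs_separated_ge beta0 Tw (grid_boxP cw) cs).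
apply: le_trans main; rewrite prob_mesh_event -EFinM lee_fin.
have N0 := total_gt0 K0; set N := #|{: {ffun edge n -> 'I_K}}|%:R in N0 *.
have k0 : 0 < K%:R :> R by rewrite ltr0n.
have : #|~: B|%:R <= 2 * m / K%:R * N.
  rewrite mulrAC ler_pdivlMr//.
  have := @card_not_separated n K; rewrite -(ler_nat R) !natrM -/m -/N => h.
  apply: le_trans h; rewrite ler_pM2r// ler_nat; apply/eq_leq/eq_card => c.
  by rewrite !inE.
have : #|~: B|%:R + #|B|%:R = N by rewrite -natrD addnC cardsC.
set b := #|~: B|%:R; set g := #|B|%:R => bgN bN.
have -> : g / N = 1 - b / N.
  by rewrite -bgN addrC; field; rewrite addrC bgN gt_eqF.
have b0 : 0 <= b / N by rewrite divr_ge0// ler0n.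
have : b / N <= 2 * m / K%:R by rewrite ler_pdivrMr.
by nra.
Qed.

Lemma prob_agree_le_mesh (K : nat) : (2 < n)%N -> (0 < K)%N -> beta <= K%:R ->
  (P agree <= ((4 + 2 * expR 2) * (K%:R / m) + 16 / K%:R)%:E)%E.
Proof.
move=> n2 K0 betaK; have k0 : 0 < K%:R :> R by rewrite ltr0n.
have mn0 : (0 < #|{: edge n}|)%N.
  have : Ordinal (ltn_trans (ltn0Sn _) n2) != Ordinal (ltn_trans (ltnSn _) n2) by [].
  by move=> /edge_between[e _]; apply/card_gt0P; exists e.
have m0 : 0 < m by rewrite ltr0n.
pose B := [set c : {ffun edge n -> 'I_K} | #|tight c|%:R <= m / K%:R / 2]%SET.
have sub : mesh_event (~: B) `<=` tie_free U by move=> w [].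
(* Outside [B] there are more than [m / (2 K)] tight edges, and [beta <= K] bounds the exponential
   by [expR 2]. *)
pose b := expR 2 * (2 * (K%:R / m)).
have b0 : 0 <= b by rewrite mulr_ge0 ?expR_ge0// mulr_ge0// divr_ge0// ltW.
have main : (P (mesh_event (~: B) `&` agree) <= b%:E * P (mesh_event (~: B)))%E.
  apply: (prob_agree_le (sigma_mesh_event _) sub) => // w T [[c /= + cw] _] Tw.
  rewrite !inE -ltNge => cB.
  have := gibbs_tight_le beta0 Tw (grid_boxP cw).
  set g := gibbs _ _ _ => gt.
  have t0 : 0 < m / K%:R / 2 by rewrite !divr_gt0.
  have g0 : 0 <= g by exact: gibbs_ge0.
  have -> : b = expR 2 / (m / K%:R / 2) by rewrite /b; field; rewrite !gt_eqF.
  rewrite ler_pdivlMr//; apply: le_trans (_ : expR (2 * (beta / K%:R)) <= _).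
    by apply: le_trans gt; rewrite ler_wpM2l// ltW.
  by rewrite ler_expR -[leRHS]mulr1 ler_pM2l// ler_pdivrMr// mul1r.
have mm := sigma_measurable (sigma_mesh_event (~: B)).
have ma := measurable_agree.
apply: (@le_trans _ _ (P (mesh_event (~: B) `&` agree) + P (~` mesh_event (~: B)))%E).
  apply: le_trans (measureU2 P _ _); last 2 first.
  - exact: measurableI.
  - exact: measurableC.
  apply: le_measure; rewrite ?inE//.
    by apply: measurableU; [exact: measurableI|exact: measurableC].
  move=> w aw; have [h|h] := pselect (mesh_event (~: B) w); [left|right] => //.
rewrite probability_setC// prob_mesh_event in main *.
have N0 := total_gt0 K0; set N := #|{: {ffun edge n -> 'I_K}}|%:R in N0 main *.
set g := #|(~: B)%SET|%:R in main *.
have gN : #|B|%:R + g = N by rewrite -natrD cardsC.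
have g1 : g / N <= 1 by rewrite ler_pdivrMr// mul1r -gN lerDr ler0n.
have := @card_few_tight R n K n2 K0 mn0; rewrite -/B -/N -/m => few.
apply: (@le_trans _ _ (b%:E + (1 - g / N)%:E)%E).
  rewrite EFinB; apply: leeD => //; apply: le_trans main _.
  by rewrite -EFinM lee_fin ler_piMr.
rewrite -EFinD lee_fin.
have -> : 1 - g / N = #|B|%:R / N by rewrite -gN; field; rewrite gN gt_eqF.
have h : #|B|%:R / N <= 4 / (m / K%:R) + 16 / K%:R by rewrite ler_pdivrMr.
have e4 : 4 / (m / K%:R) = 4 * (K%:R / m) by field; rewrite !gt_eqF.
rewrite e4 in h; rewrite /b; lra.
Qed.

End Coupling.

(** * Asymptotics *)

Lemma card_edge (n : nat) : (#|{: edge n}| * 2 = n * n.-1)%N.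
Proof.
have -> : #|{: edge n}| = 'C(n, 2).
  rewrite card_sig -[in RHS](card_ord n) -card_draws.
  by apply: eq_card => A; rewrite !inE.
by rewrite -[X in (_ * X)%N]/(2`!)%N bin_ffact ffactnS ffactn1.
Qed.

Section Asymptotics.
Context (R : realType).

Lemma card_edge_le (n : nat) : #|{: edge n}|%:R <= n%:R ^+ 2 :> R.
Proof.
rewrite -natrX ler_nat; apply: (@leq_trans (#|{: edge n}| * 2)).
  by rewrite leq_pmulr.
by rewrite card_edge -mulnn leq_mul2l leq_pred orbT.
Qed.

Lemma card_edge_ge (n : nat) : (1 < n)%N ->
  n%:R ^+ 2 / 4 <= #|{: edge n}|%:R :> R.
Proof.
move=> n1; rewrite ler_pdivrMr// -natrX -natrM ler_nat.
have -> : (#|{: edge n}| * 4 = n * n.-1 * 2)%N by rewrite -card_edge -mulnA.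
by rewrite -mulnn -mulnA leq_mul2l; apply/orP; right; lia.
Qed.

Lemma negligible_ge (beta : nat -> R) : (forall n, 0 <= beta n) ->
  negligible_wrt (fun n => n%:R ^+ 2 * ln n%:R) beta ->
  \forall n \near \oo, exists K, [/\ (0 < K)%N,
    #|{: edge n}|%:R ^+ 2 * expR (- (beta n / K%:R)) <= n%:R^-1 &
    2 * #|{: edge n}|%:R / K%:R <= 20 * (n%:R ^+ 2 * ln n%:R / beta n)].
Proof.
move=> beta0 [bn0 r0].
have r1 : \forall n \near \oo, n%:R ^+ 2 * ln n%:R / beta n < 10^-1.
  have := @cvgr_lt _ _ _ _ _ _ r0 (10^-1).
  by apply; rewrite invr_gt0.
near=> n.
have n1 : (1 < n)%N by near: n; exists 2%N.
have n0 : 0 < n%:R :> R by rewrite ltr0n ltnW.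
have L0 : 0 < ln n%:R :> R by rewrite ln_gt0// ltr1n.
have b0 : 0 < beta n by rewrite lt_neqAle beta0 eq_sym andbT; near: n.
have n2 : 1 <= n%:R ^+ 2 :> R by rewrite -natrX ler1n expn_gt0 ltnW.
have rn : n%:R ^+ 2 * ln n%:R / beta n < 10^-1 by near: n.
set L := ln n%:R in L0 rn *.
have bL : 5 * L <= beta n.
  move: rn; rewrite ltr_pdivrMr// => rn.
  have : L <= n%:R ^+ 2 * L by rewrite ler_peMl// ltW.
  lra.
(* With [K] the integer part of [q], the exponent [beta / K] is at least [5 * L], so the exponential
   is at most [n ^- 5]; against [m ^+ 2 <= n ^+ 4] this leaves [1 / n]. *)
pose q := beta n / (5 * L).
have q1 : 1 <= q by rewrite ler_pdivlMr ?mul1r// mulr_gt0.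
pose K := Num.truncn q.
have /andP[Kq qK] : K%:R <= q < K.+1%:R by rewrite truncn_itv// (le_trans _ q1).
have K0 : (0 < K)%N by rewrite truncn_gt0.
have k0 : 0 < K%:R :> R by rewrite ltr0n.
exists K; split=> //.
- have h : 5 * L <= beta n / K%:R.
    rewrite ler_pdivlMr// mulrC -ler_pdivlMr//; last by rewrite mulr_gt0.
  have e5 : expR (- (beta n / K%:R)) <= n%:R ^- 5.
    rewrite expRN lef_pV2 ?posrE ?expR_gt0 ?exprn_gt0//.
    rewrite -[n%:R]lnK ?posrE// -/L -expRM_natl ler_expR.
    exact: h.
  have m2 : #|{: edge n}|%:R ^+ 2 <= n%:R ^+ 4 :> R.
    by rewrite (exprM _ 2 2) lerXn2r ?nnegrE ?exprn_ge0// card_edge_le.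
  apply: le_trans (ler_pM _ _ m2 e5) _; rewrite ?exprn_ge0 ?expR_ge0//.
  by rewrite le_eqVlt; apply/orP; left; apply/eqP; field; rewrite gt_eqF.
(* As [q >= 1], truncation loses at most a factor two. *)
- have hq : q <= 2 * K%:R.
    apply: le_trans (ltW qK) _; rewrite -natrM ler_nat mul2n -addnn.
    by rewrite -addn1 leq_add2l.
  have -> : 20 * (n%:R ^+ 2 * L / beta n) = 4 * n%:R ^+ 2 / q.
    by rewrite /q; field; rewrite !gt_eqF.
  rewrite ler_pdivlMr ?(lt_le_trans _ q1)// mulrAC ler_pdivrMr//.
  have := card_edge_le n; set m := #|_|%:R => mn.
  have : 2 * m * q <= 2 * m * (2 * K%:R) by rewrite ler_wpM2l// mulr_ge0// ler0n.
  have : m * K%:R <= n%:R ^+ 2 * K%:R by rewrite ler_wpM2r// ltW.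
  by lra.
Unshelve. all: by end_near.
Qed.

Lemma negligible_le (beta : nat -> R) : (forall n, 0 <= beta n) ->
  \forall n \near \oo, exists K, [/\ (0 < K)%N, beta n <= K%:R,
    K%:R / #|{: edge n}|%:R <= 4 * (beta n / n%:R ^+ 2) + 8 * n%:R^-1 &
    K%:R^-1 <= n%:R^-1 :> R].
Proof.
move=> beta0; near=> n.
have n1 : (1 < n)%N by near: n; exists 2%N.
have n0 : 0 < n%:R :> R by rewrite ltr0n ltnW.
have n20 : 0 < n%:R ^+ 2 :> R by rewrite exprn_gt0.
(* The first summand makes [K] exceed [beta n]; the second makes [1 / K] vanish even for bounded
   [beta], and adds only order [1 / n] to [K / m]. *)
pose K := ((Num.truncn (beta n)).+1 + n)%N.
have /andP[tb bt] := truncn_itv (beta0 n).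
exists K; split.
- by rewrite addn_gt0.
- by apply: le_trans (ltW bt) _; rewrite ler_nat leq_addr.
- have m0 := card_edge_ge n1.
  have -> : 4 * (beta n / n%:R ^+ 2) + 8 * n%:R^-1 =
    (beta n + 2 * n%:R) / (n%:R ^+ 2 / 4) by field; rewrite gt_eqF.
  apply: ler_pM; rewrite ?invr_ge0 ?ler0n//.
    rewrite natrD -addn1 natrD -addrA lerD//.
    have : 1 <= n%:R :> R by rewrite ler1n ltnW.
    lra.
  rewrite lef_pV2 ?posrE ?divr_gt0//; apply: lt_le_trans m0.
  by rewrite divr_gt0.
- have kn : n%:R <= K%:R :> R by rewrite ler_nat leq_addl.
  by rewrite lef_pV2 ?posrE// (lt_le_trans n0 kn).
Unshelve. all: by end_near.
Qed.

Lemma cvg_prob_to_1 (p : nat -> \bar R) (f : nat -> R) :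
  (forall n, p n <= 1)%E -> (\forall n \near \oo, ((1 - f n)%:E <= p n)%E) ->
  f n @[n --> \oo] --> (0 : R) -> p n @[n --> \oo] --> (1 : \bar R)%E.
Proof.
move=> p1 fp f0; apply: (@squeeze_cvge _ _ _ _ (fun n => (1 - f n)%:E) _ (fun=> 1%E)).
- by near=> n; rewrite p1 andbT; near: n.
- have -> : 1%E = (1 - 0)%:E :> \bar R by rewrite subr0.
  by apply: cvg_EFin; [apply: nearW|apply: cvgB => //; exact: cvg_cst].
- exact: cvg_cst.
Unshelve. all: by end_near.
Qed.

End Asymptotics.

Unset Implicit Arguments.

Theorem theorem1p5 (R : realType) (beta : nat -> R)
    (beta_ge0 : forall n, 0 <= beta n)
    (d : nat -> measure_display) (Omega : forall n, measurableType (d n))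
    (P : forall n, probability (Omega n) R)
    (U : forall n, edge n -> {RV (P n) >-> R})
    (U_iid : forall n, iid_uniform01 (U n))
    (WST MST : forall n, Omega n -> {set edge n})
    (WST_spec : forall n, is_WST (beta n) (U n) (WST n))
    (MST_spec : forall n, is_MST (U n) (MST n)) :
  (negligible_wrt (fun n => n%:R ^+ 2 * ln n%:R) beta ->
     P n [set w | WST n w = MST n w] @[n --> \oo] --> (1 : \bar R)%E) /\
  (negligible_wrt beta (fun n => n%:R ^+ 2) ->
     P n [set w | WST n w <> MST n w] @[n --> \oo] --> (1 : \bar R)%E).

Proof.
have inv_n : (n%:R^-1 : R) @[n --> \oo] --> (0 : R).
  apply/(@gtr0_cvgV0 R nat \oo _ (fun n => n%:R)); last exact: cvgr_idn.
  by exists 1%N => // n /=; rewrite ltr0n.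
split=> [[bn0 r0]|[_ s0]].
(* The first term bounds the Gibbs mass of the other trees, the second the probability of a coloring
   that is not well separated. *)
- pose f n : R := n%:R^-1 + 20 * (n%:R ^+ 2 * ln n%:R / beta n).
  apply: (@cvg_prob_to_1 R _ f).
  + move=> n; apply: probability_le1.
    exact: measurable_agree (WST_spec n) (MST_spec n).
  + have near_K := negligible_ge beta_ge0 (conj bn0 r0).
    near=> n; have [K [K0 e1 e2]] : exists K, [/\ (0 < K)%N,
      #|{: edge n}|%:R ^+ 2 * expR (- (beta n / K%:R)) <= n%:R^-1 &
      2 * #|{: edge n}|%:R / K%:R <= 20 * (n%:R ^+ 2 * ln n%:R / beta n)].
      by near: n.
    have n0 : (0 < n)%N by near: n; exists 1%N.
    have e3 : #|{: edge n}|%:R ^+ 2 * expR (- (beta n / K%:R)) <= 1.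
      by apply: le_trans e1 _; rewrite invf_le1 ?ler1n ?ltr0n.
    apply: le_trans (prob_agree_ge_mesh (U_iid n) (beta_ge0 n) (WST_spec n)
      (MST_spec n) K0 e3).
    by rewrite lee_fin /f; lra.
  + have -> : (0 : R) = 0 + 20 * 0 by rewrite mulr0 addr0.
    by apply: cvgD => //; apply: cvgMr.
- pose C : R := 4 + 2 * expR 2.
  (* The mesh bound on agreement, with [K / m] and [1 / K] replaced by their estimates in [n]. *)
  pose f n : R := C * (4 * (beta n / n%:R ^+ 2) + 8 * n%:R^-1) + 16 * n%:R^-1.
  have mA n := measurable_agree (WST_spec n) (MST_spec n).
  have E n : [set w | WST n w <> MST n w] = ~` [set w | WST n w = MST n w] by [].
  apply: (@cvg_prob_to_1 R _ f).
  + by move=> n; apply: probability_le1; rewrite E; exact: measurableC.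
  + have near_K := negligible_le beta_ge0.
    near=> n; have [K [K0 bK e1 e2]] : exists K, [/\ (0 < K)%N, beta n <= K%:R,
      K%:R / #|{: edge n}|%:R <= 4 * (beta n / n%:R ^+ 2) + 8 * n%:R^-1 &
      K%:R^-1 <= n%:R^-1 :> R].
      by near: n.
    have n2 : (2 < n)%N by near: n; exists 3%N.
    have := prob_agree_le_mesh (U_iid n) (beta_ge0 n) (WST_spec n)
      (MST_spec n) n2 K0 bK.
    rewrite E probability_setC// EFinB => h; apply: leeB => //.
    apply: le_trans h _; rewrite lee_fin /f; apply: lerD.
      by rewrite ler_wpM2l// addr_ge0// mulr_ge0// expR_ge0.
    by rewrite ler_wpM2l.
  + have -> : (0 : R) = C * (4 * 0 + 8 * 0) + 16 * 0 by rewrite !(mulr0, addr0).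
    apply: cvgD; last exact: cvgMr.
    by apply: cvgMr; apply: cvgD; apply: cvgMr.
Unshelve. all: by end_near.
Qed.
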